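(* Let $R$ be an associative ring with identity. If $R$ is strongly right Johns and strongly right finite dimensional, then $R$ is $QF$. (That is, the Faith–Menal conjecture, which asserts that every strongly right Johns ring is $QF$, is true for strongly right finite dimensional rings.)
   Context: For a module $M$, the Goldie dimension $\mathrm{G.dim}\, M$ equals $n$ if $M$ has an essential submodule that is a direct sum of $n$ uniform submodules; if no such integer $n$ exists, $\mathrm{G.dim}\, M=+\infty$. (A nonzero module is uniform if every nonzero submodule of it is essential.) The strongly Goldie dimension of $M$ is $\mathrm{SG.dim}\, M=\sup\{\mathrm{G.dim}(M/N) \mid N\le M\}$, which is $+\infty$ if this supremum is not finite. A ring $R$ is strongly right finite dimensional if $\mathrm{SG.dim}(R_R)<+\infty$. A ring $R$ is right Johns if it is right noetherian and every right ideal of $R$ is an annihilator, i.e. equals the right annihilator $\{r\in R : xr=0 \text{ for all } x\in X\}$ of some subset $X\subseteq R$. A ring $R$ is strongly right Johns if the matrix ring $M_{n\times n}(R)$ is right Johns for all $n\ge 1$. A ring is $QF$ (quasi-Frobenius) if it is one-sided noetherian and one-sided self-injective. *)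

(* Defs.v *)
From HB Require Import structures.
From mathcomp Require Import all_boot all_order all_algebra.
From mathcomp Require Import boolp classical_sets.

Set Implicit Arguments.
Unset Strict Implicit.
Unset Printing Implicit Defensive.

Import GRing.Theory.
Local Open Scope classical_set_scope.
Local Open Scope ring_scope.

(* [pzRingType] is the type of all associative rings with identity (the zero  *)
(* ring included). A left S-module is an [lmodType S]; a right R-module is an *)
(* [lmodType R^c], where R^c is the opposite ring.                            *)

Record submodule (S : pzRingType) (M : lmodType S) := Submodule {
  submod_set :> set M;
  submod0 : submod_set 0;
  submodD : forall x y, submod_set x -> submod_set y -> submod_set (x + y);
  submodZ : forall a x, submod_set x -> submod_set (a *: x)
}.

Definition submod_pred (S : pzRingType) (M : lmodType S) (N : submodule M) :
  {pred M} := fun x => `[< submod_set N x >].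

Lemma submod_pred_closed (S : pzRingType) (M : lmodType S) (N : submodule M) :
  submod_closed (submod_pred N).
Proof.
split=> [|a x y /asboolP Nx /asboolP Ny]; first exact/asboolP/submod0.
by apply/asboolP/submodD => //; apply: submodZ.
Qed.

HB.instance Definition _ (S : pzRingType) (M : lmodType S) (N : submodule M) :=
  GRing.isSubmodClosed.Build S M (submod_pred N) (submod_pred_closed N).

(* M / N: its additive group is MathComp's quotient {quot _}, to which we add *)
(* the scaling a *: \pi x = \pi (a *: x).                                     *)
Section QuotientModule.
Variables (S : pzRingType) (M : lmodType S) (N : submodule M).
Local Open Scope quotient_scope.

Definition quot_mod := Quotient.quot (submod_pred N).

HB.instance Definition _ := GRing.Zmodule.on quot_mod.

Definition quot_pi (x : M) : quot_mod := \pi_(Quotient.quot (submod_pred N)) x.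

Definition quot_scale (a : S) (x : quot_mod) : quot_mod :=
  quot_pi (a *: repr (x : Quotient.quot (submod_pred N))).

Lemma quot_pi_eq (x y : M) : quot_pi x = quot_pi y <-> submod_set N (x - y).
Proof.
split=> [/eqP|Nxy].
  by rewrite /quot_pi -Quotient.idealrBE => /asboolP.
by apply/eqP; rewrite /quot_pi -Quotient.idealrBE; apply/asboolP.
Qed.

Lemma quot_pi_surj (x : quot_mod) : exists y, x = quot_pi y.
Proof.
by exists (repr (x : Quotient.quot (submod_pred N))); rewrite /quot_pi reprK.
Qed.

Lemma quot_piD (x y : M) : quot_pi (x + y) = quot_pi x + quot_pi y.
Proof. exact: (raddfD (\pi_(Quotient.quot (submod_pred N)))). Qed.

Lemma quot_scale_pi (a : S) (x : M) :
  quot_scale a (quot_pi x) = quot_pi (a *: x).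
Proof.
apply/quot_pi_eq; rewrite -scalerBr; apply: submodZ.
by apply/quot_pi_eq; rewrite /quot_pi reprK.
Qed.

Lemma quot_scaleA a b x :
  quot_scale a (quot_scale b x) = quot_scale (a * b) x.
Proof. by have [y ->] := quot_pi_surj x; rewrite !quot_scale_pi scalerA. Qed.

Lemma quot_scale1 : left_id 1 quot_scale.
Proof.
by move=> x; have [y ->] := quot_pi_surj x; rewrite quot_scale_pi scale1r.
Qed.

Lemma quot_scaleDr : right_distributive quot_scale +%R.
Proof.
move=> a x y; have [u ->] := quot_pi_surj x; have [v ->] := quot_pi_surj y.
by rewrite -quot_piD !quot_scale_pi scalerDr quot_piD.
Qed.

Lemma quot_scaleDl x : {morph quot_scale^~ x : a b / a + b}.
Proof.
move=> a b; have [u ->] := quot_pi_surj x.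
by rewrite !quot_scale_pi scalerDl quot_piD.
Qed.

HB.instance Definition _ := GRing.Zmodule_isLmodule.Build S quot_mod
  quot_scaleA quot_scale1 quot_scaleDr quot_scaleDl.

Lemma quot_pi_linear : linear quot_pi.
Proof. by move=> a x y; rewrite quot_piD -quot_scale_pi. Qed.

HB.instance Definition _ :=
  GRing.isLinear.Build S M quot_mod *:%R quot_pi quot_pi_linear.

End QuotientModule.

Section Modules.
Variable S : pzRingType.
Implicit Type M : lmodType S.

Definition noetherian M : Prop :=
  forall N : nat -> submodule M, (forall k, N k `<=` N k.+1) ->
  exists k, forall l, (k <= l)%N -> N l = N k :> set M.

Definition injective_module (E : lmodType S) : Prop :=
  forall (A B : lmodType S) (i : {linear A -> B}) (f : {linear A -> E}),
  injective i -> exists g : {linear B -> E}, forall a, g (i a) = f a.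

Definition essential_in M (N U : set M) : Prop :=
  N `<=` U /\
  forall K : submodule M, K `<=` U -> K <> [set 0] :> set M ->
    N `&` K <> [set 0].

Definition uniform_submodule M (U : submodule M) : Prop :=
  U <> [set 0] :> set M /\
  forall N : submodule M, N `<=` U -> N <> [set 0] :> set M ->
    essential_in N U.

Definition submodule_sum M n (U : 'I_n -> submodule M) : set M :=
  [set x | exists2 u : 'I_n -> M, forall i, submod_set (U i) (u i) & x = \sum_i u i].

Definition direct_family M n (U : 'I_n -> submodule M) : Prop :=
  forall u : 'I_n -> M, (forall i, submod_set (U i) (u i)) -> \sum_i u i = 0 ->
  forall i, u i = 0.

(* G.dim M = n, for a natural number n *)
Definition Gdim_eq M (n : nat) : Prop :=
  exists U : 'I_n -> submodule M,
    [/\ forall i, uniform_submodule (U i), direct_family U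
      & essential_in (submodule_sum U) [set: M]].

(* SG.dim M = s, for a natural number s: all the values G.dim (M / N) are     *)
(* finite, and s is their least upper bound.                                  *)
Definition SGdim_eq M (s : nat) : Prop :=
  (forall N : submodule M, exists2 n, Gdim_eq (quot_mod N) n & (n <= s)%N) /\
  (forall b, (forall (N : submodule M) n, Gdim_eq (quot_mod N) n -> (n <= b)%N)
    -> (s <= b)%N).

End Modules.

Section Rings.
Variable R : pzRingType.

Definition left_regular_module : lmodType R := R^o.
Definition right_regular_module : lmodType R^c := (R^c)^o.

Lemma right_regular_scaleE (a : R^c) (x : right_regular_module) :
  a *: x = (x : R) * (a : R) :> R.
Proof. by []. Qed.

Definition left_noetherian : Prop := noetherian left_regular_module.
Definition right_noetherian : Prop := noetherian right_regular_module.
Definition left_self_injective : Prop := injective_module left_regular_module.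
Definition right_self_injective : Prop :=
  injective_module right_regular_module.

Definition strongly_right_finite_dimensional : Prop :=
  exists s : nat, SGdim_eq right_regular_module s.

Definition right_annihilator (X : set R) : set R :=
  [set r | forall x, X x -> x * r = 0].

Definition right_Johns : Prop :=
  right_noetherian /\
  forall I : submodule right_regular_module,
  exists X : set R, I = right_annihilator X :> set R.

Definition QF : Prop :=
  (left_noetherian \/ right_noetherian) /\
  (left_self_injective \/ right_self_injective).

End Rings.

Definition strongly_right_Johns (R : pzRingType) : Prop :=
  forall n, (1 <= n)%N -> right_Johns 'M[R]_n.

(* Main.v *)
(* If Goldie dimensions of cyclic right modules are bounded by s, an irredundant
   intersection of maximal right ideals has at most s terms, so the Jacobson
   radical J is a finite such intersection and R / J is semisimple. In a right
   Johns ring J is nilpotent: the left annihilators of the J^k stabilise, hence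
   so do the J^k, and Nakayama applies. So every nonzero cyclic right module
   has a simple submodule, and R, being right noetherian, is right artinian.
   Since right ideals of matrix rings are annihilators, a homomorphism from a
   finitely generated left ideal to R is right multiplication by an element;
   the descending chain condition on right annihilators extends this to all
   left ideals, and R is left self-injective by Baer's criterion. *)
Require Import Defs.
From HB Require Import structures.
From mathcomp Require Import all_boot all_order all_algebra.
From mathcomp Require Import boolp classical_sets.

Set Implicit Arguments.
Unset Strict Implicit.
Unset Printing Implicit Defensive.

Import GRing.Theory.
Local Open Scope classical_set_scope.
Local Open Scope ring_scope.

Local Notation "x '\is_in' N" := (submod_set N x) (at level 70).

(** * Submodules and the maximum condition *)

Section Submodules.
Variables (S : pzRingType) (M : lmodType S).
Implicit Types N A U : submodule M.

Lemma submodB N x y : x \is_in N -> y \is_in N -> x - y \is_in N.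
Proof.
by move=> Nx Ny; apply: submodD => //; rewrite -scaleN1r; apply: submodZ.
Qed.

Lemma submod_sum N (I : finType) (x : I -> M) :
  (forall i, x i \is_in N) -> \sum_i x i \is_in N.
Proof.
by move=> Nx; apply: (big_ind (submod_set N)) => //; [apply: submod0 | apply: submodD].
Qed.

Lemma submod_neq0 N x : x \is_in N -> x != 0 -> N <> [set 0] :> set M.
Proof. by move=> Nx /eqP x0 N0; apply: x0; rewrite N0 in Nx. Qed.

Lemma nonzero_elt (A : set M) : A <> [set 0] -> A 0 -> exists2 x, A x & x != 0.
Proof.
move=> nA A0; apply: contrapT => none; apply: nA.
rewrite eqEsubset; split=> [x Ax /=|_ ->//]; apply: contrapT => x0.
by apply: none; exists x => //; apply/eqP.
Qed.

Definition cyclic (x : M) : submodule M.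
Proof.
exists [set a *: x | a in setT].
- by exists 0; rewrite ?scale0r.
- by move=> _ _ [a _ <-] [b _ <-]; exists (a + b); rewrite ?scalerDl.
- by move=> a _ [b _ <-]; exists (a * b); rewrite ?scalerA.
Defined.

Definition adjoin N (x : M) : submodule M.
Proof.
exists [set y | exists2 a, a \is_in N & exists r, y = a + r *: x].
- by exists 0; [apply: submod0 | exists 0; rewrite scale0r addr0].
- move=> _ _ [a Na [r ->]] [b Nb [s ->]]; exists (a + b); first exact: submodD.
  by exists (r + s); rewrite scalerDl addrACA.
- move=> s _ [a Na [r ->]]; exists (s *: a); first exact: submodZ.
  by exists (s * r); rewrite scalerDr scalerA.
Defined.

Lemma sub_adjoin N x : N `<=` adjoin N x.
Proof. by move=> a Na; exists a => //; exists 0; rewrite scale0r addr0. Qed.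

Lemma mem_adjoin N x : x \is_in adjoin N x.
Proof. by exists 0; [apply: submod0 | exists 1; rewrite scale1r add0r]. Qed.

Definition sum_submodule n (U : 'I_n -> submodule M) : submodule M.
Proof.
exists (submodule_sum U).
- by exists (fun=> 0) => [i|]; [apply: submod0 | rewrite big1].
- move=> _ _ [u Hu ->] [v Hv ->]; exists (fun i => u i + v i) => [i|].
    exact: submodD.
  by rewrite big_split.
- move=> a _ [u Hu ->]; exists (fun i => a *: u i) => [i|].
    exact: submodZ.
  by rewrite scaler_sumr.
Defined.

Definition cap_submodule n (U : 'I_n -> submodule M) : submodule M.
Proof.
exists [set x | forall i, x \is_in U i] => /=.
- by move=> i; apply: submod0.
- by move=> x y Ux Uy i; apply: submodD.
- by move=> a x Ux i; apply: submodZ.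
Defined.

(** Without a maximal member, iterating a choice of strictly larger members from [N0] gives an
    ascending chain that never stabilises. *)
Lemma noetherian_max (P : submodule M -> Prop) N0 : noetherian M -> P N0 ->
  exists2 N, P N & forall N', P N' -> N `<=` N' -> N' `<=` N.
Proof.
move=> noeth PN0; apply: contrapT => nomax.
have step (N : {N | P N}) : exists N' : {N | P N},
    sval N `<=` sval N' /\ ~ sval N' `<=` sval N.
  case: N => N PN /=; apply: contrapT => none; apply: nomax.
  exists N => // N' PN' NN'.
  by apply: contrapT => N'N; apply: none; exists (exist _ N' PN').
have [f fP] := choice step.
pose c k := sval (iter k f (exist _ N0 PN0)).
have [k|k /(_ k.+1 (leqnSn k)) ck] := noeth c.
  by have [] := fP (iter k f (exist _ N0 PN0)).
have [_] := fP (iter k f (exist _ N0 PN0)); apply.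
by rewrite -/(c k) -ck.
Qed.

End Submodules.

(** * Goldie dimension as a bound on independent families *)

Section GoldieDimension.
Variables (S : pzRingType) (M : lmodType S).
Implicit Types N A U : submodule M.

(** The nonzero cyclic submodules [S z i] form a direct sum. The [z i] may have torsion, so a
    relation kills the terms and not the coefficients. *)
Definition independent n (z : 'I_n -> M) := (forall i, z i <> 0) /\
  forall r : 'I_n -> S, \sum_i r i *: z i = 0 -> forall i, r i *: z i = 0.

Definition Gdim_le (A : set M) (m : nat) :=
  forall n (z : 'I_n -> M), (forall i, A (z i)) -> independent z -> (n <= m)%N.

Lemma independent_scale n (z : 'I_n -> M) (a : 'I_n -> S) : independent z ->
  (forall i, a i *: z i <> 0) -> independent (fun i => a i *: z i).
Proof.
move=> [_ zi] az; split=> // r r0 i; rewrite scalerA.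
apply: (zi (fun i => r i * a i)); rewrite -[RHS]r0.
by apply: eq_bigr => j _; rewrite scalerA.
Qed.

(* If [S z j0] misses [A], each other [S z j] is moved into [A] by subtracting
   a multiple of [z j0], so at most one of the [z j] is lost. *)
Lemma Gdim_le_add_uniform A U m : Gdim_le A m -> uniform_submodule U ->
  (forall x, x \is_in A -> x \is_in U -> x = 0) ->
  Gdim_le [set x | exists2 a, a \is_in A & exists2 u, u \is_in U & x = a + u] m.+1.
Proof.
move=> Am [_ Uu] AU [//|n] z zAU zi.
have [[j0 nA]|allA] := pselect (exists j, forall r,
    r *: z j \is_in A -> r *: z j = 0); last first.
  (* Here every [S z j] meets [A], and nonzero multiples of the [z j] form an independent family of
     the same size in [A]. *)
  apply: leqW.
  have [r rP] : {r & forall j, r j *: z j \is_in A /\ r j *: z j <> 0}.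
    apply: (@choice _ _ (fun j r => r *: z j \is_in A /\ r *: z j <> 0)) => j.
    apply: contrapT => none; apply: allA; exists j => r Ar.
    by apply: contrapT => r0; apply: none; exists r.
  apply: (Am _ (fun j => r j *: z j)) => [j|]; first by case: (rP j).
  by apply: independent_scale => // j; case: (rP j).
have [z0 zr] := zi; rewrite ltnS.
have [p pP] : {p : 'I_n -> S * S & forall j,
    let w := (p j).1 *: z (lift j0 j) - (p j).2 *: z j0 in w \is_in A /\ w <> 0}.
  apply: (@choice _ _ (fun j p =>
    let w := p.1 *: z (lift j0 j) - p.2 *: z j0 in w \is_in A /\ w <> 0)) => j.
  have [a Aa [u Uu' zE]] := zAU (lift j0 j).
  have [a0 Aa0 [u0 Uu0 z0E]] := zAU j0.
  have [u_0|u_n0] := eqVneq u 0.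
    exists (1, 0) => /=; rewrite scale1r scale0r subr0; split=> //.
    by rewrite zE u_0 addr0.
  have u0_n0 : u0 != 0.
    apply/eqP => u0_0; apply: (z0 j0); rewrite -[z j0]scale1r; apply: nA.
    by rewrite scale1r z0E u0_0 addr0.
  have cyc0 v : v != 0 -> cyclic v <> [set 0] :> set M.
    by move=> v0; apply: (@submod_neq0 _ _ (cyclic v) v) => //; exists 1; rewrite ?scale1r.
  have cycU v : v \is_in U -> cyclic v `<=` U.
    by move=> Uv _ [r _ <-]; apply: submodZ.
  (* Uniformity of [U] gives a common nonzero multiple [b u = c u0], which cancels the [U]-component
     of [b z j - c z j0]. *)
  have [_ ess] := Uu (cyclic u) (cycU _ Uu') (cyc0 _ u_n0).
  have /nonzero_elt [] := ess _ (cycU _ Uu0) (cyc0 _ u0_n0).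
    by split; exists 0; rewrite ?scale0r.
  move=> x [[b _ bE] [c _ cE]] x0; exists (b, c) => /=; split.
    rewrite zE z0E !scalerDr bE cE opprD addrACA subrr addr0.
    by apply: submodB; apply: submodZ.
  (* If [w = 0], independence gives [c z j0 = 0], so [c u0 = - c a0] lies in both [A] and [U] and
     vanishes, although it was chosen nonzero. *)
  move=> w0; move/eqP: x0; apply; rewrite -cE.
  have c0 : c *: z j0 = 0.
    pose r i := if i == j0 then - c else if i == lift j0 j then b else 0.
    have ij : lift j0 j != j0 by rewrite eq_sym neq_lift.
    have : \sum_i r i *: z i = 0.
      rewrite (bigD1 j0) //= (bigD1 (lift j0 j)) //= big1 => [|i /andP[i1 i2]].
        by rewrite /r eqxx (negbTE ij) eqxx addr0 addrC scaleNr.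
      by rewrite /r (negbTE i1) (negbTE i2) scale0r.
    by move=> /zr/(_ j0); rewrite /r eqxx scaleNr => /eqP; rewrite oppr_eq0 => /eqP.
  apply: AU; last exact: submodZ.
  have -> : c *: u0 = - (c *: a0).
    by apply/eqP; rewrite -addr_eq0 addrC -scalerDr -z0E c0.
  by rewrite -scaleN1r; do 2 apply: submodZ.
apply: (Am _ (fun j => (p j).1 *: z (lift j0 j) - (p j).2 *: z j0)).
  by move=> j; case: (pP j).
split=> [j|t t0 j]; first by case: (pP j).
(* A relation among the corrected elements, rewritten as a relation among the [z i]. *)
pose r i := if unlift j0 i is Some k then t k * (p k).1 else - \sum_k t k * (p k).2.
have r0 : \sum_i r i *: z i = 0.
  rewrite (bigD1_ord j0) //= /r unlift_none -[RHS]t0 addrC.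
  under eq_bigr do rewrite liftK.
  rewrite scaleNr scaler_suml -sumrB; apply: eq_bigr => k _.
  by rewrite scalerBr !scalerA.
have := zr _ r0 (lift j0 j); rewrite /r liftK => tp0.
have := pP j => -[Aw _].
(* The [j]-th term is thus a multiple of [z j0] lying in [A], hence zero by the choice of [j0]. *)
have E : t j *: ((p j).1 *: z (lift j0 j) - (p j).2 *: z j0) = (- (t j * (p j).2)) *: z j0.
  by rewrite scalerBr !scalerA tp0 sub0r scaleNr.
by rewrite E; apply: nA; rewrite -E; apply: submodZ.
Qed.

(** Induction on [m]: directness makes [U ord0] meet the sum of the others trivially, so adding it
    raises the bound by one. *)
Lemma Gdim_le_sum m (U : 'I_m -> submodule M) :
  (forall i, uniform_submodule (U i)) -> direct_family U ->
  Gdim_le (submodule_sum U) m.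
Proof.
elim: m U => [|m IHm] U Uu Ud.
  move=> [//|n] z zU [z0 _]; case: (z0 ord0).
  by have [u _ ->] := zU ord0; rewrite big_ord0.
pose U' i := U (lift ord0 i).
have ext u0 (u' : 'I_m -> M) : u0 \is_in U ord0 -> (forall i, u' i \is_in U' i) ->
    let u i := if unlift ord0 i is Some k then u' k else u0 in
    (forall i, u i \is_in U i) /\ \sum_i u i = u0 + \sum_i u' i.
  move=> Uu0 Uu'; split=> [i|].
    by case: unliftP => [k|] ->; first exact: Uu'.
  by rewrite big_ord_recl unlift_none; under eq_bigr do rewrite liftK.
have U'd : direct_family U'.
  move=> u' Uu' u'0 i.
  have [Ue sE] := ext 0 u' (submod0 _) Uu'.
  by have := Ud _ Ue; rewrite sE u'0 addr0 => /(_ erefl (lift ord0 i)); rewrite liftK.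
have : Gdim_le (sum_submodule U') m by apply: IHm => // i; apply: Uu.
move=> /Gdim_le_add_uniform - /(_ (U ord0) (Uu _)) step n z zU zi.
apply: (step _ n z) => // [x|i].
  move=> [u' Uu' xE] Ux.
  have Unx : - x \is_in U ord0 by rewrite -scaleN1r; apply: submodZ.
  have [Ue sE] := ext (- x) u' Unx Uu'.
  have := Ud _ Ue; rewrite sE -xE addNr => /(_ erefl ord0).
  by rewrite unlift_none => /eqP; rewrite oppr_eq0 => /eqP.
have [u Uu' ->] := zU i; rewrite big_ord_recl /=.
exists (\sum_i u (lift ord0 i)).
  by exists (fun i => u (lift ord0 i)) => // k; apply: Uu'.
by exists (u ord0); [apply: Uu' | rewrite addrC].
Qed.

(** By essentiality each member of an independent family has a nonzero multiple in the sum of the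
    uniform submodules, where the bound is known. *)
Lemma Gdim_eq_le m : Gdim_eq M m -> Gdim_le setT m.
Proof.
move=> [U [Uu Ud [_ ess]]] n z _ zi.
have [r rP] : {r & forall j, submodule_sum U (r j *: z j) /\ r j *: z j <> 0}.
  apply: (@choice _ _ (fun j r => submodule_sum U (r *: z j) /\ r *: z j <> 0)) => j.
  have zj0 : cyclic (z j) <> [set 0] :> set M.
    apply: (@submod_neq0 _ _ (cyclic (z j)) (z j)).
      by exists 1; rewrite ?scale1r.
    by apply/eqP; case: zi => + _; apply.
  have /nonzero_elt [] := ess (cyclic (z j)) (fun _ _ => I) zj0.
    by split; [apply: (submod0 (sum_submodule U)) | exists 0; rewrite ?scale0r].
  by move=> x [Ux [a _ aE]] /eqP x0; exists a; rewrite aE.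
apply: (Gdim_le_sum Uu Ud (z := fun j => r j *: z j)) => [j|].
  by case: (rP j).
by apply: independent_scale => // j; case: (rP j).
Qed.

End GoldieDimension.

(** * Baer's criterion, with partial homomorphisms represented by their graphs *)

Section Baer.
Variables (S : pzRingType) (E : lmodType S).

(** By additivity, being single-valued at [0] makes [H] the graph of a homomorphism from a submodule
    of [B] to [E]. *)
Definition functional (B : lmodType S) (H : submodule (B * E)%type) :=
  forall e, (0, e) \is_in H -> e = 0.

Lemma functional_inj (B : lmodType S) (H : submodule (B * E)%type) b e e' :
  functional H -> (b, e) \is_in H -> (b, e') \is_in H -> e = e'.
Proof.
move=> fH He He'; apply/eqP; rewrite -subr_eq0; apply/eqP/fH.
by have := submodB He He'; rewrite /= -[(b, e) - (b, e')]/(b - b, e - e') subrr.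
Qed.

Definition graph (A B : lmodType S) (i : {linear A -> B}) (f : {linear A -> E}) :
  submodule (B * E)%type.
Proof.
exists [set (i a, f a) | a in setT].
- by exists 0; rewrite ?linear0.
- by move=> _ _ [a _ <-] [b _ <-]; exists (a + b); rewrite ?linearD.
- by move=> s _ [a _ <-]; exists (s *: a); rewrite ?linearZ.
Defined.

(** The graph of [r |-> G (r *: b)], defined on the left ideal of those [r] with [r *: b] in the
    domain of [G]. *)
Definition pullback (B : lmodType S) (G : submodule (B * E)%type) (b : B) :
  submodule (S^o * E)%type.
Proof.
exists [set x | (x.1 *: b, x.2) \is_in G] => /=.
- by rewrite scale0r; apply: submod0.
- by move=> x y Gx Gy; have := submodD Gx Gy; rewrite scalerDl.
- by move=> a x /(submodZ a); rewrite -scalerA.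
Defined.

(** Zorn's lemma gives a maximal graph containing that of [f] on the image of [i]. The criterion,
    applied to its pullback along any [b], shows that [b] is already in its domain. *)
Lemma Baer :
  (forall H : submodule (S^o * E)%type, functional H ->
    exists c, forall (r : S) e, (r, e) \is_in H -> e = r *: c) ->
  injective_module E.
Proof.
move=> ext A B i f i_inj.
pose base := graph i f.
pose T := {H : submodule (B * E)%type | functional H /\ base `<=` H}.
have base_fun : functional base.
  move=> e [a _ [ia <-]]; have -> : a = 0 by apply: i_inj; rewrite ia linear0.
  by rewrite linear0.
pose t0 : T := exist _ base (conj base_fun (fun _ x => x)).
pose le (H K : T) := `[< sval H `<=` sval K >].
have [||C Ctot|[G [fG bG]] Gmax] := @ZL_preorder T t0 le.
- by move=> H; apply/asboolP.
- by move=> H K L /asboolP HK /asboolP KL; apply/asboolP => x /HK/KL.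
(* A nonempty chain is bounded by its union; the empty chain needs [t0]. *)
- have [[K0 CK0]|C0] := pselect (exists K, C K); last first.
    by exists t0 => K CK; case: C0; exists K.
  pose L := [set x | exists2 K, C K & x \is_in sval K].
  have LD x y : L x -> L y -> L (x + y).
    move=> [K CK Kx] [K' CK' K'y].
    have [/asboolP KK'|/asboolP K'K] := Ctot _ _ CK CK'.
      by exists K' => //; apply: submodD => //; apply: KK'.
    by exists K => //; apply: submodD => //; apply: K'K.
  have LZ a x : L x -> L (a *: x).
    by move=> [K CK Kx]; exists K => //; apply: submodZ.
  have L0 : L 0 by exists K0 => //; apply: submod0.
  unshelve eexists; first exists (Submodule L0 LD LZ).
    split=> [e [[K [fK ?]] CK] /fK //|x bx].
    by exists K0 => //; case: (svalP K0) => _; apply.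
  by move=> K CK; apply/asboolP => x Kx; exists K.
- have total b : exists e, (b, e) \is_in G.
    have [|c cP] := ext (pullback G b).
      by move=> e /=; rewrite scale0r; apply: fG.
    pose G' := adjoin G (b, c).
    have GG' : G `<=` G' by apply: sub_adjoin.
    (* If [(g, h)] is in [G] and [g + r *: b = 0], then [(r *: b, - h)] is in [G], so [- h = r *: c]
       by the choice of [c]. *)
    have fG' : functional G'.
      move=> e [[g h] Gg [r [/= gE ->]]].
      have hE : - h = r *: c.
        apply: cP => /=; have := submodZ (-1) Gg.
        rewrite -[_ *: (g, h)]/(-1 *: g, -1 *: h) !scaleN1r.
        suff -> : - g = r *: b by [].
        by apply/eqP; rewrite eq_sym -addr_eq0 addrC gE.
      by rewrite -hE subrr.
    have t : functional G' /\ base `<=` G' by split=> // x /bG/GG'.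
    have /asboolP G'G := Gmax (exist _ G' t) (introT (asboolP _) GG').
    by exists c; apply/G'G/mem_adjoin.
  have [g gP] := choice total.
  have g_lin : linear g.
    move=> a x y; apply: (functional_inj fG (gP _)).
    exact: (submodD (submodZ a (gP x)) (gP y)).
  pose gL := GRing.isLinear.Build S B E *:%R g g_lin.
  pose g' : {linear B -> E} := HB.pack g gL.
  exists g' => a; apply: (functional_inj fG (gP _)); apply/bG.
  by exists a.
Qed.

End Baer.

(** * Maximal right ideals and the Jacobson radical *)

Section RightIdeals.
Variable R : pzRingType.
Local Notation "x '\is_in' N" := (submod_set N (x : R)) (at level 70).

Definition right_ideal := submodule (right_regular_module R).
Implicit Types I m N : right_ideal.

Lemma right_idealM I (x r : R) : x \is_in I -> x * r \is_in I.
Proof. exact (@submodZ R^c (right_regular_module R) I r x). Qed.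

Definition mk_right_ideal (A : set R) (A0 : A 0)
    (AD : forall x y, A x -> A y -> A (x + y))
    (AM : forall x r, A x -> A (x * r)) : right_ideal :=
  @Submodule _ (right_regular_module R) A A0 AD (fun r x => @AM x r).

(** Elementwise form of simplicity of [R / m]: each element outside [m] is right invertible modulo
    [m]. *)
Definition maximal m :=
  ~ (1 : R) \is_in m /\ forall x : R, ~ x \is_in m -> exists t, 1 - x * t \is_in m.

Definition jacobson : set R := [set j | forall m, maximal m -> j \is_in m].

Definition conductor I (x : R) : right_ideal.
Proof.
apply: (@mk_right_ideal [set r | x * r \is_in I]) => /=.
- by rewrite mulr0; apply: submod0.
- by move=> r s Ir Is; rewrite mulrDr; apply: submodD.
- by move=> r s Ir; rewrite mulrA; apply: right_idealM.
Defined.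

(** Left multiplication by [x] identifies [R / conductor m x] with the simple module [R / m]. *)
Lemma conductor_maximal m x : maximal m -> ~ x \is_in m -> maximal (conductor m x).
Proof.
move=> [m1 mmax] mx; split=> [|r]; first by rewrite /= mulr1.
move=> /mmax[t mt]; exists (t * x) => /=.
have -> : x * (1 - r * (t * x)) = (1 - x * r * t) * x.
  by rewrite mulrBr mulrBl mulr1 mul1r !mulrA.
exact: right_idealM.
Qed.

Lemma jacobsonMr j r : jacobson j -> jacobson (j * r).
Proof. by move=> Jj m mm; apply/right_idealM/Jj. Qed.

Lemma adjoinP I (x y : R) : y \is_in adjoin I x ->
  exists2 a : R, a \is_in I & exists r, y = a + x * r.
Proof. by []. Qed.

Definition zero_ideal : right_ideal.
Proof.
apply: (@mk_right_ideal [set 0]) => //= [x y -> ->|x r ->].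
  by rewrite addr0.
by rewrite mul0r.
Defined.

(** Take [N'] maximal among the right ideals properly inside [N]. For [x] in [N] outside [N'], the
    conductor of [x] into [N'] is a maximal right ideal, so it contains the radical. *)
Lemma jacobson_nakayama N : right_noetherian R -> ~ N `<=` [set 0] ->
  exists2 N' : right_ideal, N' `<=` N & ~ N `<=` N' /\
    forall x j : R, x \is_in N -> jacobson j -> x * j \is_in N'.
Proof.
move=> noeth N0.
have [|N' [N'N NN'] N'max] := noetherian_max (P := fun N' : right_ideal =>
    N' `<=` N /\ ~ N `<=` N') (N0 := zero_ideal) noeth.
  by split=> // _ ->; apply: submod0.
exists N' => //; split=> // x j Nx Jj.
have [|N'x] := pselect (x \is_in N'); first exact: right_idealM.
apply: (Jj (conductor N' x)); split=> [|y]; rewrite /= ?mulr1 // => N'xy.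
have top : N `<=` adjoin N' (x * y).
  apply: contrapT => nN; apply: N'xy; apply: (N'max (adjoin N' (x * y))).
  - split=> // _ /adjoinP[a /N'N Na [r ->]]; apply: submodD => //.
    by do 2 apply: right_idealM.
  - exact: sub_adjoin.
  - exact: mem_adjoin.
have [a N'a [t xE]] := adjoinP (top _ Nx); exists t.
by rewrite mulrBr mulr1 {1}xE mulrA addrK.
Qed.

(** * Annihilators and nilpotency of the radical *)

Definition left_annihilator (X : set R) : set R := [set l | forall x, X x -> l * x = 0].

Definition annihilator_ideal (X : set R) : right_ideal.
Proof.
apply: (@mk_right_ideal (right_annihilator X)).
- by move=> x _; rewrite mulr0.
- by move=> r s Xr Xs x Xx; rewrite mulrDr Xr // Xs // addr0.
- by move=> r s Xr x Xx; rewrite mulrA Xr // mul0r.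
Defined.

Lemma Johns_annihilator I : right_Johns R ->
  right_annihilator (left_annihilator I) `<=` I.
Proof.
move=> [_ /(_ I)[X IX]] y ly; rewrite IX => x Xx; apply: ly => z.
by rewrite IX; apply.
Qed.

(** Only products [r j_1 ... j_k], without their sums: annihilators and inclusions in right ideals
    do not see the difference. *)
Fixpoint jacobson_power k : set R :=
  if k is k'.+1 then
    [set x | exists2 q, jacobson_power k' q & exists2 j, jacobson j & x = q * j]
  else setT.

Lemma jacobson_powerMl k (r x : R) : jacobson_power k x -> jacobson_power k (r * x).
Proof.
elim: k x => //= k IHk _ [q Qq [j Jj ->]]; exists (r * q); first exact: IHk.
by exists j; rewrite ?mulrA.
Qed.

Lemma jacobson_powerMr k r x : jacobson_power k x -> jacobson_power k (x * r).
Proof.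
case: k => //= k [q Qq [j Jj ->]]; exists q => //; exists (j * r).
  exact: jacobsonMr.
by rewrite mulrA.
Qed.

Lemma jacobson_power_step k : jacobson_power k.+1 `<=` jacobson_power k.
Proof. by move=> _ [q Qq [j _ ->]]; apply: jacobson_powerMr. Qed.

Definition left_annihilator_power (k : nat) : right_ideal.
Proof.
apply: (@mk_right_ideal (left_annihilator (jacobson_power k))).
- by move=> x _; rewrite mul0r.
- by move=> x y Lx Ly q Qq; rewrite mulrDl Lx // Ly // addr0.
- by move=> x r Lx q Qq; rewrite -mulrA Lx //; apply: jacobson_powerMl.
Defined.

(* The left annihilators of the powers of [J] stabilise; since right ideals are
   determined by their left annihilators, so do the powers themselves. *)
Lemma jacobson_nilpotent : right_Johns R ->
  exists n, jacobson_power n `<=` [set 0].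
Proof.
move=> Johns; have [noeth _] := Johns.
pose L := left_annihilator_power.
have [|n Ln] := noeth L; first by move=> k x Lx q /jacobson_power_step/Lx.
exists n; pose N := annihilator_ideal (L n).
have QN : jacobson_power n `<=` N by move=> q Qq x; apply.
apply: contrapT => Q0.
have [|N' N'N [NN' NJ]] := @jacobson_nakayama N noeth.
  by move=> N0; apply: Q0 => q /QN/N0.
apply: NN' => y Ny; apply: (Johns_annihilator Johns) => l lN'.
apply: Ny; rewrite -(Ln n.+1 (leqnSn n)) => _ [q Qq [j Jj ->]].
by apply/lN'/NJ => //; apply: QN.
Qed.

Definition irredundant n (m : 'I_n -> right_ideal) (z : 'I_n -> R) :=
  [/\ forall i, maximal (m i), forall i, ~ z i \is_in m i
    & forall i j, i != j -> z i \is_in m j].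

Lemma irredundant_extend n (m : 'I_n -> right_ideal) z m' x :
  irredundant m z -> maximal m' -> (forall i, x \is_in m i) -> ~ x \is_in m' ->
  exists (m1 : 'I_n.+1 -> right_ideal) z1, irredundant m1 z1.
Proof.
move=> [mm mz mz'] mm' mx m'x.
have [t tP] : {t : 'I_n -> R & forall i, z i - x * t i \is_in m'}.
  apply: (@choice _ R (fun i (t : R) => z i - x * t \is_in m')) => i.
  have [_ /(_ _ m'x)[t m't]] := mm'; exists (t * z i).
  by rewrite -{1}[z i]mul1r mulrA -mulrBl; apply: right_idealM.
exists (fun i => if unlift ord0 i is Some k then m k else m').
exists (fun i => if unlift ord0 i is Some k then z k - x * t k else x).
split=> [i|i|i j].
- by case: unliftP.
- case: unliftP => // k _ mk; apply: (mz k).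
  by rewrite -(subrK (x * t k) (z k)); apply: submodD => //; apply: right_idealM.
- case: unliftP => [k ->|->]; case: unliftP => [l ->|->] //.
  rewrite (inj_eq lift_inj) => kl; apply: submodB; first exact: mz'.
  exact: right_idealM.
Qed.

Lemma irredundant_bound s n (m : 'I_n -> right_ideal) z :
  SGdim_eq (right_regular_module R) s -> irredundant m z -> (n <= s)%N.
Proof.
move=> [dim _] [mm mz mz'].
pose K : right_ideal := cap_submodule m.
have [d Gd ds] := dim K; apply: leq_trans ds.
have pi0 (x : right_regular_module R) : quot_pi K x = 0 <-> x \is_in K.
  by rewrite -[0 in X in X <-> _](linear0 (quot_pi K)) quot_pi_eq subr0.
apply: (Gdim_eq_le Gd (z := fun i => quot_pi K (z i))) => //.
split=> [i /pi0/(_ i)/mz//|r].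
have -> : \sum_i r i *: quot_pi K (z i) =
    quot_pi K (\sum_i r i *: (z i : right_regular_module R)).
  by rewrite linear_sum; apply: eq_bigr => i _; rewrite linearZ.
move=> /pi0 Kr i; rewrite -linearZ; apply/pi0 => j.
have [<-|ij] := eqVneq i j; last exact/right_idealM/mz'.
have := Kr i; rewrite (bigD1 i) //= => mri.
rewrite -[X in submod_set _ X](addrK
  (\sum_(k | k != i) r k *: (z k : right_regular_module R))).
apply: submodB => //; apply: (big_ind (submod_set (m i))).
- exact: submod0.
- exact: submodD.
- by move=> k ki; apply/right_idealM/mz'.
Qed.

Lemma jacobson_finite_intersection : strongly_right_finite_dimensional R ->
  exists n (m : 'I_n -> right_ideal) z, irredundant m z /\
    forall x, (forall i, x \is_in m i) -> jacobson x.
Proof.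
move=> [s dim]; apply: contrapT => none.
suff /(_ s.+1)[m [z /(irredundant_bound dim)]] :
    forall n, exists (m : 'I_n -> right_ideal) z, irredundant m z by rewrite ltnn.
elim=> [|n [m [z irr]]].
  by exists (fun=> zero_ideal), (fun=> 0); split; case.
apply: contrapT => nirr; apply: none; exists n, m, z; split=> // x mx m' mm'.
by apply: contrapT => m'x; apply: nirr; apply: irredundant_extend irr mm' mx m'x.
Qed.

Definition covers I I' :=
  I `<=` I' /\ ~ I' `<=` I /\
  forall N, N `<=` I' -> ~ N `<=` I -> forall x, x \is_in I' ->
    exists2 y, y \is_in N & x - y \is_in I.

Lemma exists_cover I : right_Johns R -> strongly_right_finite_dimensional R ->
  ~ (1 : R) \is_in I -> exists I', covers I I'.
Proof.
move=> Johns fd I1.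
have [x Ix xJ] : exists2 x : R, ~ x \is_in I & forall j, jacobson j -> x * j \is_in I.
  have [n Qn] := jacobson_nilpotent Johns.
  have : jacobson_power n `<=` I by move=> x /Qn ->; apply: submod0.
  elim: n {Qn} => [/(_ 1 (Logic.I))//|n IHn QI].
  have [/IHn//|nQ] := pselect (jacobson_power n `<=` I).
  apply: contrapT => none; apply: nQ => q Qq; apply: contrapT => Iq.
  by apply: none; exists q => // j Jj; apply: QI; exists q => //; exists j.
have [n [m [z [[mm mz mz'] mJ]]]] := jacobson_finite_intersection fd.
have [i Ixz] : exists i, ~ x * z i \is_in I.
  apply: contrapT => none; apply: Ix.
  have Ixz i : x * z i \is_in I by apply: contrapT => Ixz; apply: none; exists i.
  have [t tP] : {t : 'I_n -> R & forall i, 1 - z i * t i \is_in m i}.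
    by apply: (@choice _ R (fun i (t : R) => 1 - z i * t \is_in m i)) => i; apply: (mm i).2.
  have : x * (1 - \sum_i z i * t i) \is_in I.
    apply/xJ/mJ => i; rewrite (bigD1 i) //= opprD addrA; apply: submodB => //.
    apply: (big_ind (submod_set (m i))).
    - exact: submod0.
    - exact: submodD.
    - by move=> k ki; apply/right_idealM/mz'.
  rewrite mulrBr mulr1 => Ix'; rewrite -(subrK (x * \sum_i z i * t i) x).
  apply: submodD => //; rewrite mulr_sumr.
  apply: (@submod_sum _ (right_regular_module R) I) => k.
  by rewrite mulrA; apply: right_idealM.
have ann r : z i * r \is_in m i -> x * z i * r \is_in I.
  move=> mr; rewrite -mulrA; apply/xJ/mJ => j.
  by have [<-//|ij] := eqVneq i j; apply/right_idealM/mz'.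
exists (adjoin I (x * z i)); split; first exact: sub_adjoin.
split=> [/(_ _ (mem_adjoin _ _))//|N NI' NI y /adjoinP[a Ia [r ->]]].
have [b Nb Ib] : exists2 b, b \is_in N & ~ b \is_in I.
  apply: contrapT => none; apply: NI => b Nb.
  by apply: contrapT => Ib; apply: none; exists b.
have [c Ic [u bE]] := adjoinP (NI' _ Nb).
have [t mt] : exists t, 1 - u * t \is_in conductor (m i) (z i).
  apply: (conductor_maximal (mm i) (mz i)).2 => mu; apply: Ib; rewrite bE.
  by apply: submodD => //; apply: ann.
exists (b * (t * r)); first exact: right_idealM.
have -> : a + x * z i * r - b * (t * r) =
    a + x * z i * (1 - u * t) * r - c * (t * r).
  rewrite mulrBr mulr1 mulrBl bE mulrDl opprD !addrA !mulrA.
  by rewrite [RHS]addrAC.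
apply: submodB; last exact: right_idealM.
by apply: submodD => //; apply/right_idealM/ann.
Qed.

End RightIdeals.

Section Artinian.
Variable R : pzRingType.
Local Notation "x '\is_in' N" := (submod_set N (x : R)) (at level 70).
Implicit Types I N : right_ideal R.

Definition artinian_ideal I := forall P : right_ideal R -> Prop,
  (exists2 N, P N & N `<=` I) ->
  exists2 N, P N & forall N', P N' -> N' `<=` N -> N `<=` N'.

Lemma artinian_ideal_cover I I' :
  covers I I' -> artinian_ideal I -> artinian_ideal I'.
Proof.
move=> [_ [_ cov]] artI P [N0 PN0 N0I'].
have [[N PN NI]|none] := pselect (exists2 N, P N & N `<=` I).
  by apply: artI; exists N.
have [|A [N PN [NI' AE]] Amin] := artI (fun A => exists2 N, P N &
    N `<=` I' /\ A = N `&` I :> set R).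
  exists (cap_submodule (fun i : 'I_2 => if i == 0 then N0 else I)).
    exists N0 => //; split=> //; rewrite eqEsubset; split=> x /=.
      by move=> xNI; split; [apply: (xNI 0) | apply: (xNI 1)].
    by move=> [N0x Ix] i; case: ifP.
  by move=> x /(_ 1).
exists N => // N' PN' N'N x Nx.
have [|y N'y Ixy] := cov N' (fun x N'x => NI' x (N'N x N'x)) _ x (NI' x Nx).
  by move=> N'I; apply: none; exists N'.
have Axy : x - y \is_in A.
  by rewrite AE; split=> //; apply: submodB => //; apply: N'N.
pose A' := cap_submodule (fun i : 'I_2 => if i == 0 then N' else I).
have A'E : A' = N' `&` I :> set R.
  rewrite eqEsubset; split=> z /=.
    by move=> zNI; split; [apply: (zNI 0) | apply: (zNI 1)].
  by move=> [N'z Iz] i; case: ifP.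
have /(_ _ Axy) : A `<=` A'.
  apply: Amin; last by rewrite AE A'E => z [/N'N].
  by exists N' => //; split=> // z /N'N/NI'.
rewrite A'E => -[N'xy _]; rewrite -(subrK y x).
exact: (submodD (s := N')).
Qed.

Lemma right_artinian I : right_Johns R -> strongly_right_finite_dimensional R ->
  artinian_ideal I.
Proof.
move=> Johns fd.
have art0 : artinian_ideal (zero_ideal R).
  by move=> P [N PN N0]; exists N => // N' _ _ x /N0 ->; apply: submod0.
have [A artA Amax] := noetherian_max Johns.1 art0.
suff A1 : (1 : R) \is_in A.
  move=> P [N PN _]; apply: artA; exists N => // x _.
  by have := @right_idealM R A 1 x A1; rewrite mul1r.
apply: contrapT => /(exists_cover Johns fd)[A' covA].
have [AA' [A'A _]] := covA; apply: A'A; apply: Amax => //.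
exact: artinian_ideal_cover covA artA.
Qed.

End Artinian.

Section StronglyJohns.
Variable R : pzRingType.
Hypothesis Johns : strongly_right_Johns R.

Definition matrix1_ideal (I : right_ideal R) : right_ideal 'M[R]_1.
Proof.
apply: (@mk_right_ideal _ [set A : 'M[R]_1 | submod_set I (A 0 0)]) => /=.
- by rewrite mxE; apply: submod0.
- by move=> A B IA IB; rewrite mxE; apply: submodD.
- by move=> A B IA; rewrite mxE big_ord1; apply: right_idealM.
Defined.

Lemma matrix1_idealP I (r : R) :
  submod_set (matrix1_ideal I) (const_mx r : 'M[R]_1) = submod_set I r.
Proof. by rewrite /= mxE. Qed.

Lemma strongly_right_Johns_Johns : right_Johns R.
Proof.
have [noeth ann] := Johns (leqnn 1); split=> [N Nle|I].
  have [|k Nk] := noeth (fun k => matrix1_ideal (N k)).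
    by move=> k A; apply: Nle.
  exists k => l kl; rewrite eqEsubset.
  by split=> r; rewrite -!matrix1_idealP (Nk l kl).
have [X IX] := ann (matrix1_ideal I).
exists [set A 0 0 | A in X]; rewrite eqEsubset; split=> r.
  rewrite -matrix1_idealP IX => Xr _ [A XA <-].
  by have /matrixP/(_ 0 0) := Xr A XA; rewrite !mxE big_ord1 mxE.
move=> Xr; rewrite -matrix1_idealP IX => A XA.
apply/matrixP => i j; rewrite !mxE big_ord1 mxE !ord1.
by apply: Xr; exists A.
Qed.

Definition principal_ideal (T : pzRingType) (x : T) : right_ideal T.
Proof.
apply: (@mk_right_ideal _ [set x * r | r in setT]).
- by exists 0; rewrite ?mulr0.
- by move=> _ _ [r _ <-] [s _ <-]; exists (r + s); rewrite ?mulrDr.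
- by move=> _ s [r _ <-]; exists (r * s); rewrite ?mulrA.
Defined.

Lemma finite_extension n (x y : 'I_n -> R) :
  (forall u : 'I_n -> R, \sum_i u i * x i = 0 -> \sum_i u i * y i = 0) ->
  exists c, forall i, y i = x i * c.
Proof.
case: n x y => [|n] x y xy; first by exists 0; case.
pose X : 'M[R]_n.+1 := \matrix_(i, j) x i.
pose Y : 'M[R]_n.+1 := \matrix_(i, j) y i.
have [C _ CE] : submod_set (principal_ideal X) Y.
  apply: (Johns_annihilator (Johns (ltn0Sn n))) => U XU.
  have UX : U * X = 0 by apply: XU; exists 1; rewrite ?mulr1.
  apply/matrixP => i j; rewrite !mxE.
  under eq_bigr do rewrite mxE.
  apply: xy.
  have /matrixP/(_ i j) := UX; rewrite !mxE => UX0.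
  by rewrite -[RHS]UX0; apply: eq_bigr => k _; rewrite mxE.
exists (\sum_k C k 0) => i.
have /matrixP/(_ i 0) := CE; rewrite !mxE => <-.
by rewrite mulr_sumr; apply: eq_bigr => k _; rewrite mxE.
Qed.

End StronglyJohns.

(* A homomorphism [H] out of a left ideal is right multiplication by some [c]
   on each finitely generated part; if the right annihilator of that part is
   minimal, the same [c] works on any further element. *)
Lemma strongly_right_Johns_left_self_injective (R : pzRingType) :
  strongly_right_Johns R -> strongly_right_finite_dimensional R ->
  left_self_injective R.
Proof.
move=> sJohns fd; have Johns := strongly_right_Johns_Johns sJohns.
apply: Baer => H fH.
have ext n (x y : 'I_n -> R) : (forall i, submod_set H (x i, y i)) ->
    exists c, forall i, y i = x i * c.
  move=> Hxy; apply: (finite_extension sJohns) => u ux; apply: fH.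
  have := submod_sum (fun i => submodZ (u i) (Hxy i)).
  suff -> : \sum_i u i *: ((x i, y i) : (R^o * R^o)%type) =
    (\sum_i u i * x i, \sum_i u i * y i) by rewrite ux.
  by apply: (big_ind3 (fun (a b : R) (c : (R^o * R^o)%type) => c = (a, b)))
    => // ? ? ? ? ? ? -> ->.
pose ann n (x : 'I_n -> R) := annihilator_ideal (range x).
have [|_ [n [x [y [Hxy ->]]]] min] := @right_artinian R (annihilator_ideal set0)
    Johns fd (fun N => exists n (x y : 'I_n -> R),
      (forall i, submod_set H (x i, y i)) /\ N = ann n x).
  exists (ann 0%N (fun=> 0)) => [|r _ //].
  by exists 0%N, (fun=> 0), (fun=> 0); split=> // -[].
have [c cP] := ext n x y Hxy; exists c => r e Hre.
pose x' (i : 'I_n.+1) := if unlift ord0 i is Some k then x k else r.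
pose y' (i : 'I_n.+1) := if unlift ord0 i is Some k then y k else e.
have Hxy' i : submod_set H (x' i, y' i).
  by rewrite /x' /y'; case: unliftP.
have [c' c'P] := ext _ x' y' Hxy'.
have sub : ann n x `<=` ann _ x'.
  apply: min; first by exists n.+1, x', y'.
  by move=> s s0 _ [i _ <-]; apply: s0; exists (lift ord0 i); rewrite // /x' liftK.
have : submod_set (ann _ x') (c' - c).
  apply: sub => _ [i _ <-]; rewrite mulrBr -cP.
  by have := c'P (lift ord0 i); rewrite /x' /y' liftK => <-; rewrite subrr.
move=> /(_ r); rewrite mulrBr => /(_ _)/eqP.
have := c'P ord0; rewrite /x' /y' unlift_none => <-.
rewrite subr_eq0 => /(_ _)/eqP; apply.
by exists ord0; rewrite // unlift_none.
Qed.

Theorem theorem3p3 (R : pzRingType)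
    (hJohns : strongly_right_Johns R)
    (hdim : strongly_right_finite_dimensional R) :
  QF R.
Proof.
split; first by right; apply: (strongly_right_Johns_Johns hJohns).1.
by left; apply: strongly_right_Johns_left_self_injective.
Qed.
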